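(* Let $T=\{t_1,\dots,t_k\}\subset\mathbb{Z}^d$ be a finite set of $k$ distinct elements, and let $m$ be a positive integer. Assume that there exists a $d_1\times d$ matrix $L_1$ with integer entries such that the columns $L_1t_1,\dots,L_1t_k$ of $L_1T$ are pairwise distinct and form a tile (resp. $m$-tile) $T_1=\{L_1t_1,\dots,L_1t_k\}$ in $\mathbb{Z}^{d_1}$. Then $T$ itself is a tile (resp. $m$-tile) in $\mathbb{Z}^d$.
   Context: For a finite set $T=\{t_1,\dots,t_k\}\subset\mathbb{Z}^d$ of $k$ distinct elements, $T$ also denotes the $d\times k$ matrix whose $j$th column is $t_j$. The set $T$ is called a tile (in $\mathbb{Z}^d$) if $\mathbb{Z}^d$ can be tiled by translates of $T$, i.e. there is a set $\Sigma\subset\mathbb{Z}^d$ such that every $z\in\mathbb{Z}^d$ can be written as $z=\sigma+t_j$ for exactly one pair $(\sigma,j)\in\Sigma\times\{1,\dots,k\}$. For a positive integer $m$, $T$ is called an $m$-tile if the cube $[0,m)^d$ can be tiled by translates of $T$ taken mod $m$, i.e. $T$ tiles the group $\mathbb{Z}_m^d=(\mathbb{Z}/m\mathbb{Z})^d$: there is a set $\Sigma\subset\mathbb{Z}_m^d$ such that every $z\in\mathbb{Z}_m^d$ can be written as $z=\sigma+(t_j \bmod m)$ for exactly one pair $(\sigma,j)\in\Sigma\times\{1,\dots,k\}$. *)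

(* Defs.v *)
From mathcomp Require Import all_boot all_order all_algebra.

Set Implicit Arguments.
Unset Strict Implicit.
Unset Printing Implicit Defensive.

Import GRing.Theory.
Local Open Scope ring_scope.

(* A finite set of k distinct vectors of Z^d is represented by the d x k       *)
(* integer matrix whose columns are its elements.                             *)
Definition distinct_cols (d k : nat) (T : 'M[int]_(d, k)) : Prop :=
  injective (fun j : 'I_k => col j T).

Definition tiles (G : zmodType) (k : nat) (t : 'I_k -> G) : Prop :=
  exists Sigma : G -> Prop, forall z : G,
    exists! p : G * 'I_k, Sigma p.1 /\ z = p.1 + t p.2.

Definition tile (d k : nat) (T : 'M[int]_(d, k)) : Prop :=
  tiles (fun j : 'I_k => col j T).

(* Z/mZ as an additive group, for 0 < m. We avoid 'Z_m, which is Z/2Z when     *)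
(* m = 1; here m = 1 gives the trivial group.                                 *)
Notation Zmod m := 'I_(m.-1.+1).

Definition to_Zmod (m : nat) (x : int) : Zmod m := inZp `|(x %% m)%Z|%N.

Definition mtile (m d k : nat) (T : 'M[int]_(d, k)) : Prop :=
  tiles (fun j : 'I_k => map_mx (to_Zmod m) (col j T) : 'cV[Zmod m]_d).

(* Main.v *)
Require Import Defs.
From mathcomp Require Import all_boot all_order all_algebra.

(** Tilings pull back along group homomorphisms. Let [phi : G -> H] be additive
    and suppose that the translates of the family [phi \o t] by [Sigma] tile
    [H]. Then the translates of [t] by the preimage of [Sigma] tile [G]:
    writing [phi z = s + phi (t j)] forces the index [j], and then the translate
    [z - t j] of [G], which does lie over [s] ([tiles_pullback]).

    For tiles, [phi] is multiplication by [L1] from Z^d to Z^d1. For m-tiles it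
    is multiplication by [L1] modulo [m] ([mulzmx]), and what has to be checked
    is that reduction modulo [m] intertwines the two ([map_mulzmx]), which holds
    because that reduction is additive ([to_ZmodD]). *)

Import GRing.Theory.

Local Open Scope ring_scope.

(** The translation set is the preimage of the given one: a decomposition of [z]
    in [G] is sent by [phi] to the decomposition of [phi z], so it has the index
    prescribed there, and the index determines the translate. *)
Lemma tiles_pullback (G H : zmodType) (k : nat) (phi : G -> H)
    (t : 'I_k -> G) (u : 'I_k -> H) :
    {morph phi : x y / x + y} -> (forall j, phi (t j) = u j) ->
  tiles u -> tiles t.
Proof.
move=> phiD phit [Sigma tilS]; exists (fun g => Sigma (phi g)) => z.
have [[s j] [/= [Ss zE] uniq_sj]] := tilS (phi z).
exists (z - t j, j); split=> /= [|[g i] /= [Sg zE']].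
  split; last by rewrite subrK.
  suff ->: phi (z - t j) = s by [].
  by apply: (addIr (u j)); rewrite -zE -phit -phiD subrK.
have [] : (s, j) = (phi g, i) by apply: uniq_sj; rewrite zE' phiD phit.
by move=> _ ->; rewrite zE' addrK.
Qed.

(** Every abelian group is a module over the integers, so integer matrices act
    on its column vectors. Iterated addition in place of a ring product treats
    all moduli alike, including [m = 1], where the ring of residues is zero. *)
Definition mulzmx (A : zmodType) (p q : nat) (L : 'M[int]_(p, q))
    (v : 'cV[A]_q) : 'cV[A]_p :=
  \col_i \sum_j v j 0 *~ L i j.

Lemma mulzmxD (A : zmodType) (p q : nat) (L : 'M[int]_(p, q)) :
  {morph @mulzmx A p q L : v w / v + w}.
Proof.
move=> v w; apply/matrixP=> i o; rewrite !mxE -big_split /=.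
by apply: eq_bigr => j _; rewrite mxE mulrzDl.
Qed.

(** A homomorphism out of the integers commutes with integer linear
    combinations; with [f] the reduction modulo [m], the reduced columns of [T]
    are sent to the reduced columns of [L1 *m T]. *)
Lemma map_mulzmx (A : zmodType) (f : int -> A) (p q : nat)
    (L : 'M[int]_(p, q)) (v : 'cV[int]_q) :
    {morph f : x y / x + y} ->
  mulzmx A p q L (map_mx f v) = map_mx f (L *m v).
Proof.
move=> fD.
have f0 : f 0 = 0 by apply: (addIr (f 0)); rewrite -fD !add0r.
have fN x : f (- x) = - f x by apply: (addIr (f x)); rewrite -fD !addNr.
have fMn x n : f (x *+ n) = f x *+ n.
  by elim: n => [|n IHn]; rewrite ?mulr0n // !mulrS fD IHn.
have fMz x n : f (n * x) = f x *~ n.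
  rewrite mulrC -mulrzz; case: n => n; first by rewrite -!pmulrn fMn.
  by rewrite NegzE !mulrNz fN -!pmulrn fMn.
apply/matrixP=> i o; rewrite !mxE ord1.
by rewrite (big_morph f fD f0); apply: eq_bigr => j _; rewrite mxE fMz.
Qed.

Lemma to_ZmodD (m : nat) :
  (0 < m)%N -> {morph to_Zmod m : x y / x + y}.
Proof.
case: m => // m _ x y; apply: val_inj; rewrite /= modnDm; apply/eqP.
have abs_modz z : (`|(z %% m.+1)%Z|%N : int) = (z %% m.+1)%Z.
  by rewrite gez0_abs // modz_ge0.
by rewrite -eqz_nat -!modz_nat PoszD !abs_modz modzDm modz_mod.
Qed.

Theorem proposition2p3 (d k m : nat) (T : 'M[int]_(d, k))
    (m_gt0 : (0 < m)%N) (T_distinct : distinct_cols T) :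
  ((exists (d1 : nat) (L1 : 'M[int]_(d1, d)),
      distinct_cols (L1 *m T) /\ tile (L1 *m T)) ->
    tile T)
  /\
  ((exists (d1 : nat) (L1 : 'M[int]_(d1, d)),
      distinct_cols (L1 *m T) /\ mtile m (L1 *m T)) ->
    mtile m T).
Proof.
have col_mulmx d1 (L1 : 'M[int]_(d1, d)) j : col j (L1 *m T) = L1 *m col j T.
  by rewrite !colE mulmxA.
split=> -[d1 [L1 [_ tilL1T]]].
  apply: (tiles_pullback _ _ _ (mulmx L1) _ _ _ _ tilL1T) => [v w|j].
    exact: mulmxDr.
  by rewrite col_mulmx.
apply: (tiles_pullback _ _ _ (mulzmx _ _ _ L1) _ _ _ _ tilL1T) => [|j].
  exact: mulzmxD.
by rewrite col_mulmx; apply/map_mulzmx/to_ZmodD.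
Qed.
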